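(* Let $N\simeq\mathbb{Z}^n$ be a lattice and let $N_{\mathbb{R}}=N\otimes_{\mathbb{Z}}\mathbb{R}$. Let $L_\sigma,L_\tau\subset N_{\mathbb{R}}$ be rational linear subspaces satisfying $L_\sigma+L_\tau=N_{\mathbb{R}}$. Define the lattices $N_\sigma=L_\sigma\cap N$ and $N_\tau=L_\tau\cap N$. Then $N_\sigma+N_\tau$ has finite index in $N$. Moreover, if $u_1,\dots,u_a$ is a $\mathbb{Z}$-basis of $N_\sigma$ and $v_1,\dots,v_b$ is a $\mathbb{Z}$-basis of $N_\tau$, where $a+b=n$, then $$[N:N_\sigma+N_\tau]=|\det(M)|,$$ where $M=(u_1,\dots,u_a,v_1,\dots,v_b)$ is the $n\times n$ integer matrix whose columns are the basis vectors.
   Context: A linear subspace of $N_{\mathbb{R}}$ is rational if it is spanned over $\mathbb{R}$ by vectors of $N$ (equivalently, of $N\otimes\mathbb{Q}$). The columns of $M$ are the coordinates of the basis vectors under the identification $N\simeq\mathbb{Z}^n$. *)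

(* Defs.v *)
From HB Require Import structures.
From mathcomp Require Import all_boot all_order all_algebra.
From mathcomp Require Import boolp classical_sets functions cardinality reals.

Set Implicit Arguments.
Unset Strict Implicit.
Unset Printing Implicit Defensive.

Import GRing.Theory.
Local Open Scope classical_set_scope.
Local Open Scope ring_scope.

(* The universal property of N -> N (x)_Z R, with finite-dimensional targets;
   these suffice because it is only used for N of finite rank, where N (x)_Z R
   is itself finite-dimensional. *)
Definition is_scalar_extension (R : realType) (N : zmodType) (NR : vectType R)
    (iota : {additive N -> NR}) : Prop :=
  forall (W : vectType R) (f : {additive N -> W}),
    exists! g : 'Hom(NR, W), forall x, g (iota x) = f x.

Definition rational_subspace (R : realType) (N : zmodType) (NR : vectType R)
    (iota : {additive N -> NR}) (L : {vspace NR}) : Prop :=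
  exists s : seq N, L = <<[seq iota x | x <- s]>>%VS.

Definition lattice_points (R : realType) (N : zmodType) (NR : vectType R)
    (iota : {additive N -> NR}) (L : {vspace NR}) : set N :=
  [set x | iota x \in L].

Definition set_sum (N : zmodType) (A B : set N) : set N :=
  [set x + y | x in A & y in B].

Definition cosets (N : zmodType) (H : set N) : set (set N) :=
  range (fun x : N => [set x + h | h in H]).

Definition is_zbasis (N : zmodType) (A : set N) (a : nat) (u : 'I_a -> N) :
    Prop :=
  A = range (fun c : 'I_a -> int => \sum_(i < a) u i *~ c i) /\
  forall c : 'I_a -> int,
    \sum_(i < a) u i *~ c i = 0 -> forall i, c i = 0.

Definition basis_matrix (N : zmodType) (n : nat) (phi : N -> 'cV[int]_n)
    (a b : nat) (ab : (a + b)%N = n) (u : 'I_a -> N) (v : 'I_b -> N) :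
    'M[int]_n :=
  castmx (erefl n, ab)
    (row_mx (\matrix_(i < n, j < a) phi (u j) i 0)
            (\matrix_(i < n, j < b) phi (v j) i 0)).

(* Main.v *)
Require Import Defs.
From HB Require Import structures.
From mathcomp Require Import all_boot all_order all_algebra.
From mathcomp Require Import boolp classical_sets functions cardinality reals.

Set Implicit Arguments.
Unset Strict Implicit.
Unset Printing Implicit Defensive.

Import GRing.Theory.
Local Open Scope classical_set_scope.
Local Open Scope ring_scope.

(** The theorem is a statement about integer matrices, once N is identified
    with column vectors by phi.

    The index of a full-rank sublattice A Z^n is |det A|: the Smith normal form
    A = L D Q, with L and Q invertible over the integers and D diagonal, shows
    that Z^n / A Z^n is isomorphic to the product of the Z / d_i Z, and
    |det A| is the product of the |d_i| because det L and det Q are 1 or -1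
    ([card_cosets_im]).

    N_sigma + N_tau contains such a sublattice ([exists_sublattice]). Rational
    generators of L_sigma and of L_tau together span N_R. The universal
    property supplies a linear map from N_R to R^n that extends phi, so the
    integer coordinate vectors of these generators span R^n, and n of them have
    a nonzero determinant. The lattice spanned by those n vectors lies in
    N_sigma + N_tau and has finite index, so N_sigma + N_tau has finite index.

    If moreover N_sigma and N_tau have bases forming the columns of M, then
    N_sigma + N_tau is itself M Z^n ([set_sum_basis_matrix]). Since M Z^n
    contains some A Z^n with det A nonzero, A = M C for an integer matrix C, so
    det M is nonzero ([det_neq0_im_sub]) and the index formula applies to M. *)

(** * Cosets *)

(** A surjection f whose fibres are the cosets of H identifies the quotient
    with the finite type T. That H is a subgroup follows from the second
    hypothesis. *)
Lemma card_cosets (N : zmodType) (T : finType) (H : set N) (f : N -> T) :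
  (forall t, exists x, f x = t) ->
  (forall x y, f x = f y <-> H (x - y)) ->
  (cosets H #= `I_#|T|)%card.
Proof.
move=> f_surj f_eq.
have cosetE x : [set x + h | h in H] = [set y | f y = f x].
  apply/seteqP; split => y /=.
    by move=> [h Hh <-]; apply/f_eq; rewrite addrAC subrr add0r.
  by move/f_eq => Hyx; exists (y - x) => //; rewrite addrC subrK.
have -> : cosets H = range (fun i : 'I_#|T| => [set y | f y = enum_val i]).
  apply/seteqP; split => C /=.
    by move=> [x _ <-]; exists (enum_rank (f x)); rewrite // enum_rankK cosetE.
  move=> [i _ <-]; have [x fx] := f_surj (enum_val i).
  by exists x; rewrite // cosetE fx.
apply: card_eq_trans (card_esym card_II); apply: inj_card_eq => i j _ _ eq_ij.
have [x fx] := f_surj (enum_val i).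
have : [set y | f y = enum_val i] x by [].
by rewrite eq_ij /= fx; apply: enum_val_inj.
Qed.

(** Each coset of the larger G is the sum of a coset of H and G, so the
    quotient by H maps onto the quotient by G. *)
Lemma finite_cosetsS (N : zmodType) (H G : set N) :
  H `<=` G -> H 0 -> (forall x y, G x -> G y -> G (x + y)) ->
  finite_set (cosets H) -> finite_set (cosets G).
Proof.
move=> HG H0 GD finH.
apply: (@sub_finite_set _ _ [set set_sum C G | C in cosets H]); last first.
  exact: finite_image.
move=> _ [x _ <-]; exists [set x + h | h in H] => /=; first by exists x.
apply/seteqP; split => y.
  move=> [_ [h Hh <-] [g Gg <-]]; exists (h + g); last by rewrite addrA.
  by apply: GD => //; apply: HG.
by move=> [g Gg <-]; exists x; [exists 0; rewrite ?addr0|exists g].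
Qed.

(** * The index of a full-rank sublattice *)

Lemma absz_det_unitmx n (A : 'M[int]_n) : A \in unitmx -> `|\det A|%N = 1%N.
Proof.
move=> A_unit; have := congr1 (absz \o determinant) (mulmxV A_unit).
by rewrite /= det_mulmx abszM det1 => /eqP; rewrite muln_eq1 => /andP[/eqP].
Qed.

(** In the Smith normal form A = L D Q, the image of A is L D Z^n because Q is
    invertible. So x lies in it exactly when each coordinate of L^-1 x is
    divisible by the corresponding d_i, and the residues of these coordinates
    classify the cosets. *)
Lemma card_cosets_im (n : nat) (N : zmodType) (phi : {additive N -> 'cV[int]_n})
    (A : 'M[int]_n) : bijective phi -> \det A != 0 ->
  (cosets [set x | exists c, phi x = A *m c] #= `I_(`|\det A|%N))%card.
Proof.
move=> [psi phiK psiK] detA.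
have [L Lu [Q Qu [d _ defA]]] := int_Smith_normal_form A.
pose e (i : 'I_n) : int := d`_i.
have defD : \matrix_(i < n, j < n) (d`_i *+ (i == j :> nat))
    = diag_mx (\row_i e i).
  by apply/matrixP => i j; rewrite !mxE.
rewrite {}defD in defA.
have absA : `|\det A|%N = (\prod_(i < n) `|e i|)%N.
  rewrite defA !det_mulmx !abszM (absz_det_unitmx Lu) (absz_det_unitmx Qu).
  rewrite mul1n muln1 det_diag.
  rewrite (big_morph absz abszM (erefl _ : `|1%R : int| = 1)%N).
  by under eq_bigr do rewrite mxE.
have d_neq0 (i : 'I_n) : e i != 0.
  rewrite -absz_gt0; move: detA; rewrite -absz_gt0 absA !lt0n.
  by apply: contraNN => /eqP di0; rewrite (bigD1 i) //= di0.
(* As |d_i| > 0, it is written as a successor so that inord applies. *)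
pose q (i : 'I_n) := (absz (e i)).-1.
have qE i : ((q i).+1 = `|e i|)%N by rewrite prednK // absz_gt0.
pose T := {dffun forall i, 'I_(q i).+1}.
have -> : `|\det A|%N = #|{: T}|.
  rewrite absA card_dep_ffun foldrE big_map big_enum /=.
  by apply: eq_bigr => i _; rewrite card_ord qE.
pose f x : T :=
  [ffun i => inord `|((invmx L *m phi x) i 0%R %% e i)%Z|%N].
have lt_mod (z : int) i : (`|(z %% e i)%Z| < (q i).+1)%N.
  by rewrite qE -ltz_nat gez0_abs ?modz_ge0 // ltz_mod.
apply: (card_cosets (f := f)) => [t|x y].
  (* A family of residues is attained by L times the column of residues. *)
  exists (psi (L *m \col_i (t i : nat)%:Z)).
  apply/ffunP => i; rewrite ffunE psiK mulKmx // mxE.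
  rewrite -modz_abs -qE modz_nat absz_nat modn_small //.
  by apply: val_inj; rewrite /= inordK.
have -> : f x = f y <-> forall i, (e i %| (invmx L *m phi (x - y)) i 0%R)%Z.
  have fE i : (f x i == f y i) = (e i %| (invmx L *m phi (x - y)) i 0%R)%Z.
    rewrite raddfB mulmxBr !mxE -eqz_mod_dvd !ffunE -val_eqE /= !inordK //.
    by rewrite -eqz_nat !gez0_abs ?modz_ge0 // !mxE.
  split=> [fxy i | dvd]; first by rewrite -fE fxy.
  by apply/ffunP => i; apply/eqP; rewrite fE.
split=> /= [dvd|[c xyE] i].
  exists (invmx Q *m \col_i ((invmx L *m phi (x - y)) i 0%R %/ e i)%Z).
  rewrite defA -!mulmxA mulKVmx //; apply: (canRL (mulKVmx Lu)).
  apply/matrixP => i j; rewrite ord1 mul_diag_mx !mxE mulrC divzK //.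
  by have := dvd i; rewrite mxE.
rewrite xyE defA -!mulmxA mulKmx // mul_diag_mx !mxE.
exact: dvdz_mulr.
Qed.

(** * A full-rank sublattice of the sum *)

Lemma lattice_points0 (R : realType) (N : zmodType) (NR : vectType R)
  (iota : {additive N -> NR}) (L : {vspace NR}) : lattice_points iota L 0.
Proof. by rewrite /lattice_points /= raddf0 mem0v. Qed.

Lemma lattice_pointsD (R : realType) (N : zmodType) (NR : vectType R)
    (iota : {additive N -> NR}) (L : {vspace NR}) x y :
  lattice_points iota L x -> lattice_points iota L y ->
  lattice_points iota L (x + y).
Proof. by rewrite /lattice_points /= raddfD; apply: memvD. Qed.

(** Full rank is known over R only, but the determinant of an integer submatrix
    vanishes over R if and only if it vanishes over the integers. *)
Lemma nondegenerate_minor (R : realType) (n m : nat) (A : 'M[int]_(m, n)) :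
  row_full (map_mx intr A : 'M[R]_(m, n)) ->
  exists f : 'I_n -> 'I_m, \det (rowsub f A) != 0.
Proof.
move=> Afull; exists (fullrankfun Afull).
have := fullrowsub_unit Afull.
by rewrite -map_mxsub unitmxE unitfE det_map_mx intr_eq0.
Qed.

(** If the iota w_i span N_R, the coordinate vectors of the w_i span R^n: the
    linear map extending phi sends the iota w_i to these vectors, and its image
    contains the standard basis. *)
Lemma row_full_scalar_extension (R : realType) (n : nat) (N : zmodType)
    (phi : {additive N -> 'cV[int]_n}) (NR : vectType R)
    (iota : {additive N -> NR}) (m : nat) (w : m.-tuple N) :
  bijective phi -> is_scalar_extension iota ->
  <<[seq iota x | x <- w]>>%VS = fullv ->
  row_full (map_mx intr (\matrix_(i < m) (phi (tnth w i))^T) : 'M[R]_(m, n)).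
Proof.
move=> [psi phiK psiK] iotaP w_span.
have [g [gE _]] :=
  iotaP _ (map_mx intr \o trmx \o phi : {additive N -> 'rV[R]_n}).
have {}gE x : g (iota x) = map_mx intr (phi x)^T by exact: gE.
rewrite -sub1mx; apply/row_subP => j; rewrite rowE mulmx1.
have -> : delta_mx 0 j = g (iota (psi (delta_mx j 0))).
  by apply: esym; apply: etrans (gE _) _; rewrite psiK trmx_delta map_delta_mx.
have : iota (psi (delta_mx j 0)) \in <<map_tuple iota w>>%VS.
  by rewrite /= w_span memvf.
move=> /coord_span ->; rewrite linear_sum summx_sub // => i _.
rewrite linearZ scalemx_sub // (nth_map 0) ?size_tuple //.
have gwE : g (iota w`_i) = row i (map_mx intr (\matrix_i (phi (tnth w i))^T)).
  by apply: etrans (gE _) _; rewrite -map_row rowK (tnth_nth 0).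
by apply: submx_trans (row_sub i _); rewrite -gwE.
Qed.

(** Rationality is what makes this true: it provides spanning families of L_sigma
    and L_tau consisting of lattice points. A basis of R^n extracted from the
    union of the two families consists of elements of N_sigma or N_tau. *)
Lemma exists_sublattice (R : realType) (n : nat) (N : zmodType)
    (phi : {additive N -> 'cV[int]_n}) (NR : vectType R)
    (iota : {additive N -> NR}) (Ls Lt : {vspace NR}) :
  bijective phi -> is_scalar_extension iota ->
  rational_subspace iota Ls -> rational_subspace iota Lt ->
  (Ls + Lt)%VS = fullv ->
  exists2 A : 'M[int]_n, \det A != 0 &
    [set x | exists c, phi x = A *m c] `<=`
      set_sum (lattice_points iota Ls) (lattice_points iota Lt).
Proof.
move=> phi_bij iotaP [s sE] [t tE] LsDLt.
have w_span : <<[seq iota x | x <- in_tuple (s ++ t)]>>%VS = fullv.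
  by rewrite /= map_cat span_cat -sE -tE.
have [f detA] :=
  nondegenerate_minor (row_full_scalar_extension phi_bij iotaP w_span).
exists (rowsub f (\matrix_i (phi (tnth (in_tuple (s ++ t)) i))^T))^T.
  by rewrite det_tr.
move=> x [c xE].
have {xE} -> : x = \sum_i tnth (in_tuple (s ++ t)) (f i) *~ c i 0.
  apply: (bij_inj phi_bij); rewrite xE raddf_sum; apply/colP => i.
  rewrite mxE summxE; apply: eq_bigr => j _.
  by rewrite !mxE raddfMz -scaler_int !mxE mulrC intz.
elim/big_ind: _ => [|x1 x2 [a1 Pa1 [b1 Pb1 <-]] [a2 Pa2 [b2 Pb2 <-]]|i _].
- exists 0; first exact: lattice_points0.
  by exists 0; [exact: lattice_points0|rewrite addr0].
- exists (a1 + a2); first exact: lattice_pointsD.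
  by exists (b1 + b2); [exact: lattice_pointsD|rewrite addrACA].
have := mem_tnth (f i) (in_tuple (s ++ t)); set y := tnth _ _.
rewrite mem_cat => /orP[ys|yt].
  exists (y *~ c i 0); last by exists 0; [exact: lattice_points0|rewrite addr0].
  rewrite /lattice_points /= raddfMz -scaler_int memvZ // sE.
  by rewrite memv_span // map_f.
exists 0; first exact: lattice_points0.
exists (y *~ c i 0); last by rewrite add0r.
rewrite /lattice_points /= raddfMz -scaler_int memvZ // tE.
by rewrite memv_span // map_f.
Qed.

(** * Bases and the determinant *)

Lemma set_sum_basis_matrix (n : nat) (N : zmodType)
    (phi : {additive N -> 'cV[int]_n}) (S T : set N) (a b : nat)
    (ab : (a + b)%N = n) (u : 'I_a -> N) (v : 'I_b -> N) :
  injective phi -> is_zbasis S u -> is_zbasis T v ->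
  set_sum S T = [set x | exists c, phi x = basis_matrix phi ab u v *m c].
Proof.
case: n / ab phi => phi phi_inj [-> _] [-> _].
have comb k (w : 'I_k -> N) (c : 'I_k -> int) :
    phi (\sum_i w i *~ c i) = (\matrix_(i, j) phi (w j) i 0) *m \col_i c i.
  apply/colP => i; rewrite raddf_sum mxE summxE; apply: eq_bigr => j _.
  by rewrite !mxE raddfMz -scaler_int !mxE mulrC intz.
rewrite /basis_matrix castmx_id; apply/seteqP; split => x /=.
  move=> [_ [c _ <-] [_ [e _ <-] <-]].
  exists (col_mx (\col_i c i) (\col_i e i)).
  by rewrite mul_row_col raddfD /= !comb.
move=> [c xE]; exists (\sum_i u i *~ usubmx c i 0).
  by exists (fun i => usubmx c i 0).
exists (\sum_i v i *~ dsubmx c i 0); first by exists (fun i => dsubmx c i 0).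
apply: phi_inj; rewrite raddfD /= !comb xE -[in RHS](vsubmxK c).
rewrite mul_row_col; congr (_ + _).
  by congr (_ *m _); apply/colP => i; rewrite !mxE.
by congr (_ *m _); apply/colP => i; rewrite !mxE.
Qed.

(** Choosing a preimage under M of each column of A gives A = M C. *)
Lemma det_neq0_im_sub n (A M : 'M[int]_n) : \det A != 0 ->
  (forall c : 'cV_n, exists e : 'cV_n, A *m c = M *m e) -> \det M != 0.
Proof.
move=> detA AM.
have [C CE] := boolp.choice (fun j : 'I_n => AM (delta_mx j 0)).
have AE : A = M *m (\matrix_j (C j)^T)^T.
  apply: trmx_inj; apply/row_matrixP => j.
  by rewrite -tr_col colE CE !trmx_mul trmxK row_mul rowK.
by apply: contraNneq detA => M0; rewrite AE det_mulmx M0 mul0r.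
Qed.

Theorem theorem7p1 (R : realType) (n : nat) (N : zmodType)
    (phi : {additive N -> 'cV[int]_n}) (phi_bij : bijective phi)
    (NR : vectType R) (iota : {additive N -> NR})
    (iotaP : is_scalar_extension iota)
    (Ls Lt : {vspace NR})
    (ratLs : rational_subspace iota Ls) (ratLt : rational_subspace iota Lt)
    (LsDLt : (Ls + Lt)%VS = fullv) :
  let Ns := lattice_points iota Ls in
  let Nt := lattice_points iota Lt in
  finite_set (cosets (set_sum Ns Nt)) /\
  forall (a b : nat) (ab : (a + b)%N = n) (u : 'I_a -> N) (v : 'I_b -> N),
    is_zbasis Ns u -> is_zbasis Nt v ->
    (cosets (set_sum Ns Nt) #= `I_(`|\det (basis_matrix phi ab u v)|%N))%card.
Proof.
move=> Ns Nt.
have [A detA subA] := exists_sublattice phi_bij iotaP ratLs ratLt LsDLt.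
split=> [|a b ab u v Nsu Ntv].
  apply: (finite_cosetsS subA).
  - by exists 0; rewrite mulmx0 raddf0.
  - move=> _ _ [a1 Pa1 [b1 Pb1 <-]] [a2 Pa2 [b2 Pb2 <-]].
    exists (a1 + a2); first exact: lattice_pointsD.
    by exists (b1 + b2); [exact: lattice_pointsD|rewrite addrACA].
  - by exists `|\det A|%N; apply: card_cosets_im.
rewrite (set_sum_basis_matrix ab (bij_inj phi_bij) Nsu Ntv).
apply: card_cosets_im => //; apply: (det_neq0_im_sub detA) => c.
have [psi _ psiK] := phi_bij.
have : set_sum Ns Nt (psi (A *m c)) by apply: subA; exists c.
by rewrite (set_sum_basis_matrix ab (bij_inj phi_bij) Nsu Ntv) /= psiK.
Qed.
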